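(* Let $\Delta\subset\mathbb{R}^n$ be an open lattice simplex of dimension $d$, with vertices $v_1,\ldots,v_{d+1}\in\mathbb{Z}^n$ listed in any order, and let $d'\geq d$ be an integer. Put $a_i=(v_{i,1},\ldots,v_{i,n},1)\in\mathbb{Z}^{n+1}$ for $i=1,\ldots,d+1$ (these are the vertices of $\Delta\times\{1\}$, and they are linearly independent). Let $(f^*_0,\ldots,f^*_{d'})=f^*(L_\Delta,d')$. Then for every $0\leq i\leq d'$, $f^*_i$ equals the number of atomic lattice points, with respect to the ordered generators $a_1,\ldots,a_{d+1}$, that lie at level $i+1$ in the half-open fundamental simplex of $\operatorname{cone}_{\mathbb{R}}(a_1,\ldots,a_{d+1})$.
   Context: An open lattice simplex is the relative interior of the convex hull of finitely many affinely independent points of $\mathbb{Z}^n$. Its Ehrhart function is $L_\Delta(k)=\#(\mathbb{Z}^n\cap k\Delta)$ for integers $k\geq1$; it agrees for all $k\geq 1$ with a unique polynomial of degree at most $d$, also denoted $L_\Delta$. For a polynomial $p$ of degree at most $d'$, its $f^*$-vector $f^*(p,d')=(f^*_0,\ldots,f^*_{d'})$ is the unique vector with $p(k)=\sum_{i=0}^{d'} f^*_i\binom{k-1}{i}$, where $\binom{x}{i}=x(x-1)\cdots(x-i+1)/i!$. Atomic lattice points: let $w_1,\ldots,w_r\in\mathbb{Z}^N$ be linearly independent (ordered). $\operatorname{cone}_{\mathbb{R}}(w_1,\ldots,w_r)$ is the set of non-negative real combinations and $\operatorname{cone}_{\mathbb{Z}}(w_1,\ldots,w_s)$ the set of non-negative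 integer combinations of the listed vectors. The half-open fundamental simplex is $\Delta^\circ(w_1,\ldots,w_r)=\{\sum_{i=1}^r\lambda_i w_i : \lambda_i>0,\ \sum_i\lambda_i\leq r\}$. A point $z=\sum_i\lambda_iw_i$ of the cone with $\sum_i\lambda_i>0$ is at level $k=\operatorname{lev}(z)$, where $k$ is the integer with $k-1<\sum_i\lambda_i\leq k$. Let $\operatorname{Lev}(k)$ be the set of points of $\mathbb{Z}^N\cap\Delta^\circ(w_1,\ldots,w_r)$ at level $k$. Define inductively $T_1=\operatorname{Lev}(1)$ and, for $k=2,\ldots,r$, $T_k=\operatorname{Lev}(k)\setminus\bigcup_{i=1}^{k-1}\bigcup_{z\in T_i}\big(z+\operatorname{cone}_{\mathbb{Z}}(w_1,\ldots,w_i)\big)$. The atomic lattice points are the elements of $T_1\cup\cdots\cup T_r$. *)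

(* Defs.v *)
From HB Require Import structures.
From mathcomp Require Import all_boot all_order all_algebra finmap.
From mathcomp Require Import all_classical all_reals all_analysis.

Set Implicit Arguments.
Unset Strict Implicit.
Unset Printing Implicit Defensive.

Import Order.TTheory GRing.Theory Num.Theory.
Import numFieldNormedType.Exports.

Local Open Scope classical_set_scope.
Local Open Scope ring_scope.

Definition real_point (R : realType) (n : nat) (z : 'rV[int]_n) : 'rV[R]_n :=
  map_mx intr z.

Definition lattice_points (R : realType) (n : nat) (A : set 'rV[R]_n) :
    set 'rV[int]_n :=
  [set z | A (real_point R z)].

(* Only meaningful for finite A: [fset_set A] is empty when A is infinite. *)
Definition card_set (T : choiceType) (A : set T) : nat := #|` fset_set A |.

Definition convex_hull (R : realType) (n : nat) (A : set 'rV[R]_n) :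
    set 'rV[R]_n :=
  [set x | exists (m : nat) (p : 'I_m -> 'rV[R]_n) (c : 'I_m -> R),
     [/\ forall i, A (p i), forall i, 0 <= c i, \sum_i c i = 1
       & x = \sum_i c i *: p i]].

Definition affine_hull (R : realType) (n : nat) (A : set 'rV[R]_n) :
    set 'rV[R]_n :=
  [set x | exists (m : nat) (p : 'I_m -> 'rV[R]_n) (c : 'I_m -> R),
     [/\ forall i, A (p i), \sum_i c i = 1 & x = \sum_i c i *: p i]].

(* Interior of A for the topology induced on its affine hull. *)
Definition relative_interior (R : realType) (n : nat) (A : set 'rV[R]_n) :
    set 'rV[R]_n :=
  [set x | A x /\ \forall y \near x, affine_hull A y -> A y].

Definition affinely_independent (R : realType) (n m : nat)
    (p : 'I_m -> 'rV[R]_n) : Prop :=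
  forall c : 'I_m -> R,
    \sum_i c i = 0 -> \sum_i c i *: p i = 0 -> forall i, c i = 0.

Definition open_simplex (R : realType) (n m : nat) (v : 'I_m -> 'rV[int]_n) :
    set 'rV[R]_n :=
  relative_interior (convex_hull (range (fun i => real_point R (v i)))).
Arguments open_simplex R {n m} v.

Definition dilate (R : realType) (n : nat) (k : nat) (A : set 'rV[R]_n) :
    set 'rV[R]_n :=
  [set k%:R *: x | x in A].

Definition ehrhart (R : realType) (n : nat) (A : set 'rV[R]_n) (k : nat) : nat :=
  card_set (lattice_points (dilate k A)).

Definition ehrhart_poly (R : realType) (n : nat) (d : nat) (A : set 'rV[R]_n) :
    {poly R} :=
  xget 0 [set p : {poly R} | (size p <= d.+1)%N /\
    forall k : nat, (1 <= k)%N -> p.[k%:R] = (ehrhart A k)%:R].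

Definition rbinom (R : realType) (x : R) (i : nat) : R :=
  (\prod_(j < i) (x - j%:R)) / (i`!)%:R.

Definition fstar (R : realType) (p : {poly R}) (d : nat) : 'rV[R]_d.+1 :=
  xget 0 [set f : 'rV[R]_d.+1 |
    forall x : R, p.[x] = \sum_(i < d.+1) f 0 i * rbinom (x - 1) i].

Section Atomic.
Variables (R : realType) (N r : nat) (w : 'I_r -> 'rV[int]_N).

Definition half_open_simplex : set 'rV[R]_N :=
  [set x | exists l : 'I_r -> R,
     [/\ forall i, 0 < l i, \sum_i l i <= r%:R
       & x = \sum_i l i *: real_point R (w i)]].

Definition at_level (k : nat) : set 'rV[R]_N :=
  [set x | exists l : 'I_r -> R,
     [/\ forall i, 0 <= l i, x = \sum_i l i *: real_point R (w i),
         0 < \sum_i l i & k%:R - 1 < \sum_i l i <= k%:R]].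

Definition Lev (k : nat) : set 'rV[int]_N :=
  lattice_points (half_open_simplex `&` at_level k).

(* The cone over the first s generators. *)
Definition coneZ (s : nat) : set 'rV[int]_N :=
  [set x | exists c : 'I_r -> nat, x = \sum_(j < r | (j < s)%N) w j *+ c j].

Definition translated_cones (i : nat) (T : set 'rV[int]_N) : set 'rV[int]_N :=
  \bigcup_(z in T) [set z + y | y in coneZ i].

(* [covered k] is the union of [translated_cones i (T_ i)] over 1 <= i <= k,
   where T_ (k + 1) is Lev (k + 1) minus [covered k]; see [T_E]. *)
Fixpoint covered (k : nat) : set 'rV[int]_N :=
  if k is k'.+1 then
    covered k' `|` translated_cones k (Lev k `\` covered k')
  else set0.

Definition T_ (k : nat) : set 'rV[int]_N := Lev k `\` covered k.-1.

Definition atomic : set 'rV[int]_N :=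
  \bigcup_(k in [set k | (1 <= k <= r)%N]) T_ k.

Lemma T_E (k : nat) : T_ k =
  Lev k `\` \bigcup_(i in [set i | (1 <= i < k)%N]) \bigcup_(z in T_ i)
               [set z + y | y in coneZ i].
Proof.
suff H m : covered m = \bigcup_(i in [set i | (1 <= i <= m)%N])
    translated_cones i (T_ i).
  rewrite {1}/T_ H; congr (_ `\` _); apply: eq_bigcupl; split=> i /=.
    by case: k => [|k] //=; case: i.
  by case: k => [|k] //=; case: i.
elim: m => [|m IH] /=.
  by apply/seteqP; split=> // x [[|i]].
rewrite -[Lev m.+1 `\` _]/(T_ m.+1) IH; apply/seteqP; split=> x.
  case=> [[i /= /andP[i0 im] xi]|xm].
    by exists i => //=; rewrite i0 leqW.
  by exists m.+1 => //=.
case=> i /= /andP[i0]; rewrite leq_eqVlt ltnS => /orP[/eqP-> xm|im xi].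
  by right.
by left; exists i => //=; rewrite i0.
Qed.

End Atomic.

Lemma finite_int_box (n B : nat) :
  finite_set [set z : 'rV[int]_n | forall j, `|z 0 j| <= B%:Z].
Proof.
pose f (y : 'rV['I_(B + B).+1]_n) : 'rV[int]_n :=
  \row_j ((y 0 j : nat)%:Z - B%:Z).
apply: (@sub_finite_set _ _ (range f)); last first.
  by apply: finite_image; apply: finite_finset.
move=> z /= zB.
have zb j : 0 <= z 0 j + B%:Z <= (B + B)%:Z.
  by have := zB j; rewrite ler_norml PoszD -lerBlDr sub0r lerD2r.
exists (\row_j inord (absz (z 0 j + B%:Z))) => //.
apply/rowP => j; rewrite !mxE inordK; last first.
  have /andP[z0 z1] := zb j.
  by rewrite ltnS -lez_nat gez0_abs.
by have /andP[z0 _] := zb j; rewrite gez0_abs// addrK.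
Qed.

Lemma finite_lattice_points (R : realType) (n : nat) (A : set 'rV[R]_n) (B : R) :
  (forall x, A x -> forall j, `|x 0 j| <= B) -> finite_set (lattice_points A).
Proof.
move=> AB; apply: sub_finite_set (finite_int_box n (Num.bound `|B|)) => z /= Az j.
have := AB _ Az j; rewrite mxE -intr_norm => zB.
rewrite -(@ler_int R); apply: (le_trans zB); apply: ltW.
apply: le_lt_trans (ler_norm _) _.
exact: archi_boundP (normr_ge0 _).
Qed.

Lemma combination_bound (R : realType) (n m : nat) (p : 'I_m -> 'rV[R]_n)
    (c : 'I_m -> R) (j : 'I_n) :
  (forall i, 0 <= c i) ->
  `|(\sum_i c i *: p i) 0 j| <=
    (\sum_i c i) * \big[Num.max/0]_i \big[Num.max/0]_j `|p i 0 j|.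
Proof.
move=> c0; rewrite summxE mulr_suml; apply: le_trans (ler_norm_sum _ _ _) _.
apply: ler_sum => i _; rewrite mxE normrM (ger0_norm (c0 i)) ler_wpM2l//.
apply: le_trans (le_bigmax _ _ i).
exact: (le_bigmax _ (fun j => `|p i 0 j|)).
Qed.

Lemma finite_Lev (R : realType) (N r : nat) (w : 'I_r -> 'rV[int]_N) (k : nat) :
  finite_set (Lev R w k).
Proof.
apply: (finite_lattice_points (B := r%:R * \big[Num.max/0]_i \big[Num.max/0]_j
   `|real_point R (w i) 0 j|)) => _ [[l [l0 lr ->]] _] j.
apply: le_trans (combination_bound _ _ _) _; first by move=> i; exact: ltW.
by apply: ler_wpM2r => //; exact: bigmax_ge_id.
Qed.

Lemma finite_dilate_open_simplex (R : realType) (n m : nat)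
    (v : 'I_m -> 'rV[int]_n) (k : nat) :
  finite_set (lattice_points (dilate k (open_simplex R v))).
Proof.
set B := \big[Num.max/0]_i \big[Num.max/0]_j `|real_point R (v i) 0 j|.
apply: (finite_lattice_points (B := k%:R * B)) => _ [x [Hx _] <-] j.
case: Hx => s [p [c [Hp c0 c1 ->]]].
rewrite mxE normrM (ger0_norm (ler0n _ _)) ler_wpM2l//.
apply: le_trans (combination_bound _ _ c0) _; rewrite c1 mul1r.
apply/bigmax_leP; split=> [|i _]; first exact: bigmax_ge_id.
have [a _ <-] := Hp i.
exact: (le_bigmax _ (fun a => \big[Num.max/0]_j `|real_point R (v a) 0 j|)).
Qed.

(* Main.v *)
Require Import Defs.
From mathcomp Require Import all_boot all_order all_algebra finmap.
From mathcomp Require Import all_classical all_reals all_analysis.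
From mathcomp Require Import zify lra.

(* Let lambda(z) be the coordinates of a lattice point z of the open cone over
   the generators, and let its height be the sum of these coordinates; it is an
   integer because every generator has last entry 1.  The set T_k turns out to be
   the set of points of height k with lambda_j <= 1 for all j < k.  Every lattice
   point of the open cone is then z + y for a unique k <= r, z in T_k and
   y in cone_Z(w_1, ..., w_k).  Such a translated cone has C(m - 1, k - 1) points
   at height m, one for each weak composition of m - k into k parts, so
   L(m) = sum_k #T_k C(m - 1, k - 1), which is the expansion defining f*. *)

Set Implicit Arguments.
Unset Strict Implicit.
Unset Printing Implicit Defensive.

Import Order.TTheory GRing.Theory Num.Theory.
Import numFieldNormedType.Exports.

Local Open Scope classical_set_scope.
Local Open Scope ring_scope.

(** * Lattice points and cardinalities *)

Lemma real_pointD (R : realType) (n : nat) :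
  {morph @real_point R n : x y / x + y}.
Proof. exact: map_mxD. Qed.

Lemma real_pointB (R : realType) (n : nat) :
  {morph @real_point R n : x y / x - y}.
Proof. exact: map_mxB. Qed.

Lemma real_point_inj (R : realType) (n : nat) : injective (@real_point R n).
Proof.
move=> x y /rowP xy; apply/rowP => j.
by have := xy j; rewrite !mxE => /intr_inj.
Qed.

(** Takes the ceiling of [x] minus 1 as [m]: the remainder in []0, 1]] keeps coordinates positive,
    as the open cone requires. *)
Lemma unit_remainder (R : realType) (x : R) :
  0 < x -> exists m : nat, 0 < x - m%:R <= 1.
Proof.
move=> x0; have ex : exists m : nat, x <= m.+1%:R.
  exists (Num.bound x); apply/ltW/(lt_trans (archi_boundP (ltW x0))).
  by rewrite ltr_nat.
exists (ex_minn ex); case: ex_minnP => m xm min_m.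
have mx : m%:R < x.
  case: m xm min_m => [//|m] _ min_m.
  by rewrite ltNge; apply/negP => /min_m; rewrite ltnn.
by rewrite subr_gt0 mx lerBlDr addrC natr1.
Qed.

Lemma card_set_range (F : finType) (T : choiceType) (f : F -> T) :
  injective f -> card_set (range f) = #|F|.
Proof.
move=> f_inj; rewrite /card_set.
have -> : fset_set (range f) = [fset f x | x in F]%fset.
  apply/fsetP => y; apply/idP/imfsetP => /=.
    rewrite in_fset_set; last exact/finite_image/finite_finset.
    by rewrite inE => -[x _ <-]; exists x.
  case=> x _ ->; rewrite in_fset_set; last exact/finite_image/finite_finset.
  by rewrite inE; exists x.
by rewrite card_imfset //= cardE.
Qed.

Lemma card_set_image (T U : choiceType) (f : T -> U) (A : set T) :
  finite_set A -> injective f -> card_set (f @` A) = card_set A.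
Proof.
by move=> finA f_inj; rewrite /card_set fset_set_image // card_imfset.
Qed.

(* Weak compositions of m - (i + 1) into i + 1 parts; the condition is written
   as a sum because it must fail when m <= i. *)
Definition composition (m i : nat) : finType :=
  {t : i.+1.-tuple 'I_(m - i.+1).+1 | (\sum_(x <- t) x + i.+1 == m)%N}.

(** Stars and bars; for [m <= i] both sides vanish. *)
Lemma card_composition (m i : nat) : (0 < m)%N ->
  #|composition m i| = 'C(m.-1, i).
Proof.
move=> m0; rewrite card_sig; have [im|im] := leqP i.+1 m.
  have -> : m.-1 = (i + (m - i.+1))%N by lia.
  rewrite -card_ord_partitions cardsE; apply: eq_card => t.
  by rewrite !inE; lia.
rewrite bin_small; last by lia.
by apply: eq_card0 => t; rewrite !inE; lia.
Qed.

(** * Unique decomposition of the lattice points of the open cone *)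

Section Decomposition.
Variables (R : realType) (N r : nat) (w : 'I_r -> 'rV[int]_N).

Definition gen_mx : 'M[R]_(r, N) := \matrix_i real_point R (w i).

(* Meaningful when the generators are independent and z is in their span. *)
Definition coord (z : 'rV[int]_N) : 'rV[R]_r :=
  real_point R z *m pinvmx gen_mx.

Definition in_span (z : 'rV[int]_N) : Prop :=
  real_point R z = coord z *m gen_mx.

(** Not confined to the half-open simplex, unlike [Lev]: the Ehrhart function needs heights above
    [r] too. *)
Definition slice (k : nat) : set 'rV[int]_N :=
  [set z | [/\ in_span z, forall i, 0 < coord z 0 i
             & \sum_i coord z 0 i = k%:R]].

(* In the 1-based numbering of the paper: the coordinates of index < k are at
   most 1. *)
Definition base (k : nat) : set 'rV[int]_N :=
  [set z | slice k z /\ forall j : 'I_r, (j.+1 < k)%N -> coord z 0 j <= 1].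

Definition shift (s : nat) (c : 'I_r -> nat) : 'rV[int]_N :=
  \sum_(j < r | (j < s)%N) w j *+ c j.

Hypothesis gen_free : row_free gen_mx.
Hypothesis integral_height : forall z, in_span z ->
  (forall i, 0 < coord z 0 i) -> exists m : nat, \sum_i coord z 0 i = m%:R.

Lemma coordE (z : 'rV[int]_N) (l : 'I_r -> R) :
  real_point R z = \sum_i l i *: real_point R (w i) ->
  in_span z /\ forall i, coord z 0 i = l i.
Proof.
move=> zE; have {}zE : real_point R z = (\row_i l i) *m gen_mx.
  rewrite zE mulmx_sum_row; apply: eq_bigr => i _.
  by rewrite rowK mxE.
have cz : coord z = \row_i l i by rewrite /coord zE mulmxKp.
by split=> [|i]; rewrite /in_span cz ?mxE.
Qed.

Lemma in_spanE (z : 'rV[int]_N) : in_span z ->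
  real_point R z = \sum_i coord z 0 i *: real_point R (w i).
Proof.
move=> ->; rewrite mulmx_sum_row; apply: eq_bigr => i _.
by rewrite rowK.
Qed.

Lemma coordD : {morph coord : x y / x + y}.
Proof. by move=> x y; rewrite /coord real_pointD mulmxDl. Qed.

Lemma in_spanD (x y : 'rV[int]_N) : in_span x -> in_span y -> in_span (x + y).
Proof.
by move=> xs ys; rewrite /in_span coordD mulmxDl -xs -ys real_pointD.
Qed.

Lemma in_spanB (x y : 'rV[int]_N) : in_span x -> in_span y -> in_span (x - y).
Proof.
move=> xs ys; rewrite /in_span /coord real_pointB mulmxBl mulmxBl.
by rewrite -/(coord x) -/(coord y) -xs -ys.
Qed.

Lemma coord_inj (x y : 'rV[int]_N) : in_span x -> in_span y ->
  (forall i, coord x 0 i = coord y 0 i) -> x = y.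
Proof.
move=> xs ys xy; apply: (@real_point_inj R).
by rewrite xs ys; congr (_ *m _); apply/rowP.
Qed.

Lemma shiftP (s : nat) (c : 'I_r -> nat) : in_span (shift s c) /\
  forall i, coord (shift s c) 0 i = (if (i < s)%N then c i else 0%N)%:R.
Proof.
apply: coordE; rewrite /shift big_mkcond /= /real_point raddf_sum /=.
apply: eq_bigr => i _; case: ifP => _; last by rewrite map_mx0 scale0r.
by rewrite scaler_nat raddfMn.
Qed.

Lemma coord_shift (z : 'rV[int]_N) (s : nat) (c : 'I_r -> nat) (i : 'I_r) :
  coord (z + shift s c) 0 i =
  coord z 0 i + (if (i < s)%N then c i else 0%N)%:R.
Proof. by rewrite coordD mxE (shiftP s c).2. Qed.

Lemma slice_uniq (k m : nat) (z : 'rV[int]_N) :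
  slice k z -> slice m z -> k = m.
Proof. by case=> _ _ zk [_ _]; rewrite zk => /eqP; rewrite eqr_nat => /eqP. Qed.

Lemma shift_slice (m s : nat) (z : 'rV[int]_N) (c : 'I_r -> nat) :
  slice m z -> slice (m + \sum_(j < r | (j < s)%N) c j) (z + shift s c).
Proof.
case=> zs z0 zm; split.
- by apply: in_spanD => //; apply: (shiftP s c).1.
- by move=> i; rewrite coord_shift ltr_wpDr.
under eq_bigr do rewrite coord_shift.
by rewrite big_split /= zm natrD -natr_sum [in RHS]big_mkcond.
Qed.

(* Writing c_j = ceil(coord_j) - 1, the index s is the least one for which
   s + c_1 + ... + c_s reaches the height m of x: all of c_1, ..., c_(s-1) and
   then as much of c_s as is needed to descend to height s are removed. *)
Lemma base_shift_exists (m : nat) (x : 'rV[int]_N) : (0 < m)%N -> slice m x ->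
  exists s z c, [/\ (0 < s <= r)%N, base s z & x = z + shift s c].
Proof.
move=> m0 [xs x0 xm].
have /boolp.choice[c cP] i := unit_remainder (x0 i).
pose S (t : nat) := (\sum_(j < r | (j < t)%N) c j)%N.
(* Each coordinate is at most [c i + 1], so the index [r] reaches the height and a least such index
   exists. *)
have Sr : (m <= r + S r)%N.
  rewrite -(ler_nat R) -xm natrD /S natr_sum.
  have -> : r%:R = \sum_(i < r) (1 : R) by rewrite sumr_const card_ord.
  rewrite (eq_bigl xpredT) => [|i]; last by rewrite ltn_ord.
  rewrite -big_split /=; apply: ler_sum => i _.
  by have /andP[_] := cP i; rewrite lerBlDr.
have ex : exists t, (m <= t + S t)%N by exists r.
case: (ex_minnP ex) => s ms min_s.
have sr : (s <= r)%N by exact: min_s.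
have s0 : (0 < s)%N.
  case: s ms {min_s sr} => // ; rewrite /S big_pred0 ?addn0 => [|//].
  by rewrite leqNgt m0.
case: s s0 sr ms min_s => // s _ sr ms min_s.
pose i0 := Ordinal sr.
have SS : S s.+1 = (c i0 + S s)%N.
  rewrite /S (bigD1 i0) //=; congr addn; apply: eq_bigl => j.
  by rewrite ltnS ltn_neqAle andbC -val_eqE.
have lt_s : (s + S s < m)%N.
  by rewrite ltnNge; apply/negP => /min_s; rewrite ltnn.
(* Here [s] is the 0-based position of the last generator used. By [lt_s] the subtractions do not
   truncate, and the removed total is [m - s.+1]. *)
pose b (j : 'I_r) := if (j < s)%N then c j else (m - s.+1 - S s)%N.
have b_le (j : 'I_r) : (j < s.+1)%N -> (b j <= c j)%N.
  rewrite /b ltnS leq_eqVlt; case: ltnP => // _; rewrite orbF => /eqP js.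
  have -> : j = i0 by apply: val_inj.
  lia.
have Sb : (\sum_(j < r | (j < s.+1)%N) b j = m - s.+1)%N.
  rewrite (bigD1 i0) //= {1}/b ltnn.
  rewrite (eq_big (fun j : 'I_r => (j < s)%N) c); first by rewrite -/(S s); lia.
    by move=> j; rewrite ltnS ltn_neqAle andbC -val_eqE.
  move=> j /andP[]; rewrite ltnS leq_eqVlt -val_eqE /= => /orP[-> //|js _].
  by rewrite /b js.
pose z := x - shift s.+1 b.
have xE : x = z + shift s.+1 b by rewrite subrK.
have cz j : coord x 0 j = coord z 0 j + (if (j < s.+1)%N then b j else 0%N)%:R.
  by rewrite {1}xE coord_shift.
have zs : in_span z by apply: in_spanB => //; apply: (shiftP _ b).1.
exists s.+1, z, b; split => //; split; last first.
  move=> j; rewrite ltnS => js; have /andP[_] := cP j.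
  by rewrite cz /b js (ltn_trans js) // addrK.
split => //.
  move=> j; have := x0 j; rewrite cz; case: ifP => js; last by rewrite addr0.
  move=> _; have /andP[+ _] := cP j; rewrite cz js => c0.
  have : (b j)%:R <= (c j)%:R :> R by rewrite ler_nat b_le.
  by move: c0; lra.
have : \sum_i coord x 0 i = \sum_i coord z 0 i + (m - s.+1)%:R.
  rewrite -Sb natr_sum [X in _ = _ + X]big_mkcond -big_split /=; apply: eq_bigr => j _.
  by rewrite cz; case: ifP.
rewrite xm natrB; last by lia.
by move: (\sum_i _) => y; lra.
Qed.

(** The two coordinates differ by an integer. If [j.+1 < s], a larger coordinate of [z] would exceed
    a positive number by at least 1, against the bound in [base s]. If [t <= j], the shift of [y]
    does not reach [j]. *)
Lemma base_shift_coord_le (s t : nat) (z y : 'rV[int]_N) (c e : 'I_r -> nat)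
    (j : 'I_r) :
  base s z -> base t y -> z + shift s c = y + shift t e ->
  (j.+1 < s)%N || (t <= j)%N -> coord z 0 j <= coord y 0 j.
Proof.
move=> [_ zb] [[_ y0 _] _] zy.
have : coord (z + shift s c) 0 j = coord (y + shift t e) 0 j by rewrite zy.
rewrite !coord_shift; move: (if _ then c j else _) => a ab.
case/orP => [js|tj]; last first.
  by move: ab; rewrite ltnNge tj addr0 => <-; rewrite lerDl.
move: (if _ then e j else _) ab => b ab; rewrite leNgt; apply/negP => lt_yz.
have a_b : (a.+1 <= b)%N by rewrite -(ltr_nat R); lra.
have : a%:R + 1 <= b%:R :> R by rewrite natr1 ler_nat.
by have := zb j js; have := y0 j; lra.
Qed.

Lemma base_shift_uniq (s t : nat) (z y : 'rV[int]_N) (c e : 'I_r -> nat) :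
  base s z -> base t y -> z + shift s c = y + shift t e -> s = t /\ z = y.
Proof.
wlog ts : s t z y c e / (t <= s)%N.
  move=> wl bz yb zy; have [ts|/ltnW st] := leqP t s; first exact: (wl _ _ _ _ c e).
  by have [-> ->] := wl _ _ _ _ e c st yb bz (esym zy).
move=> bz yb zy; have [[zs _ zh] _] := bz; have [[ys _ yh] _] := yb.
have le_zy := base_shift_coord_le bz yb zy.
move: ts; rewrite leq_eqVlt => /orP[/eqP ts|ts]; last first.
  (* When [t < s], every index meets one of the two alternatives of [base_shift_coord_le], so the
     heights compare. *)
  suff : s%:R <= t%:R :> R by rewrite ler_nat leqNgt ts.
  by rewrite -zh -yh; apply: ler_sum => j _; apply: le_zy; lia.
split=> //; subst t; apply: coord_inj => //.
have le_yz := base_shift_coord_le yb bz (esym zy).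
have eq_zy (j : 'I_r) : j.+1 != s -> coord z 0 j = coord y 0 j.
  by move=> js; apply/le_anti; rewrite le_zy ?le_yz //; lia.
(* The only index left is settled by the equal heights. *)
move=> i; have [iE|/eq_zy //] := eqVneq i.+1 s.
have : \sum_i coord z 0 i = \sum_i coord y 0 i by rewrite zh yh.
rewrite (bigD1 i) //= [in RHS](bigD1 i) //= => zyi; 
apply: (addIr (\sum_(j < r | j != i) coord y 0 j)); rewrite -zyi; congr (_ + _).
by apply: eq_bigr => j ji; rewrite eq_zy // -iE eqSS.
Qed.

(** The level rounds the coordinate sum up; since that sum is an integer, level and height agree. *)
Lemma Lev_slice (k : nat) : (0 < k <= r)%N -> Lev R w k = slice k.
Proof.
move=> /andP[k0 kr]; apply/seteqP; split=> z /=.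
  case=> [[l [l0 _ /coordE[zs zl]]] [l' [_ /coordE[_ zl'] _]]].
  have z0 i : 0 < coord z 0 i by rewrite zl.
  have -> : \sum_i l' i = \sum_i coord z 0 i by apply: eq_bigr => i _; rewrite zl'.
  have [m zm] := integral_height zs z0.
  rewrite zm ltrBlDr natr1 ltr_nat ler_nat.
  by move=> km; split=> //; rewrite zm; congr _%:R; lia.
case=> zs z0 zk; split; exists (coord z 0); split=> //.
- by rewrite zk ler_nat.
- exact: in_spanE.
- by move=> i; exact: ltW.
- exact: in_spanE.
- by rewrite zk ltr0n.
- by rewrite zk lexx gtrBl ltr01.
Qed.

(** The half-open simplex bounds the coordinate sum by [r]. This makes the entries of the f*-vector
    beyond the dimension vanish. *)
Lemma Lev_gt (k : nat) : (r < k)%N -> Lev R w k = set0.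
Proof.
case: k => // k rk; rewrite -subset0 => z.
case=> [[l [_ lr /coordE[_ zl]]] [l' [_ /coordE[_ zl'] _ /andP[+ _]]]].
have -> : \sum_i l' i = \sum_i l i by apply: eq_bigr => i _; rewrite -zl -zl'.
rewrite -natr1 addrK => /lt_le_trans /(_ lr); rewrite ltr_nat => kr.
by rewrite ltnS leqNgt kr in rk.
Qed.

Lemma shift0 (s : nat) : shift s (fun=> 0%N) = 0.
Proof. by rewrite /shift big1 // => j _; rewrite mulr0n. Qed.

(** By strong induction the cones already removed start at points of [base i] with [i < k].
    Existence of the decomposition leaves nothing outside [base k]; uniqueness shows that no point
    of [base k] is removed. *)
Lemma T_base (k : nat) : (0 < k <= r)%N -> T_ R w k = base k.
Proof.
elim/ltn_ind: k => k IH kr; rewrite T_E Lev_slice //.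
have IHk i : (0 < i < k)%N -> T_ R w i = base i.
  by move=> ik; apply: IH; lia.
apply/seteqP; split=> x.
  case=> xk xN; have [s [z [c [sr bz xE]]]] := base_shift_exists (andP kr).1 xk.
  (* Comparing heights gives [s <= k], with zero shift when [s = k]. *)
  have := shift_slice s c bz.1; rewrite -xE => /(slice_uniq xk) kE.
  have [sk|sk] := ltnP s k.
    exfalso; apply: xN; exists s; first by rewrite /=; lia.
    exists z; first by rewrite IHk //; lia.
    by exists (shift s c); [exists c|].
  suff -> : x = z by have <- : s = k by lia.
  rewrite xE /shift big1 ?addr0 // => j js.
  have /eqP : (\sum_(j < r | (j < s)%N) c j = 0)%N by lia.
  by rewrite sum_nat_eq0 => /forallP /(_ j) /implyP /(_ js) /eqP ->.
move=> bx; split; first exact: bx.1.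
case=> i /= ik [z]; rewrite IHk // => bz [_ [c ->]] zx.
(* The zero shift decomposes [x] with index [k], so uniqueness would force [i = k]. *)
have : z + shift i c = x + shift k (fun=> 0%N) by rewrite shift0 addr0.
by case/(base_shift_uniq bz bx) => ? _; lia.
Qed.

(** All points of [T_ i] have height [i], so only [T_ k] meets level [k]. *)
Lemma atomic_Lev (k : nat) : (0 < k <= r)%N ->
  atomic R w `&` Lev R w k = base k.
Proof.
move=> kr; apply/seteqP; split=> z.
  case=> -[i /= ir Tz]; rewrite Lev_slice // => zk.
  move: Tz; rewrite T_base // => bz.
  by rewrite (slice_uniq zk bz.1).
move=> bz; split; last by rewrite Lev_slice //; exact: bz.1.
by exists k => //; rewrite T_base.
Qed.

Lemma finite_base (k : nat) : (0 < k <= r)%N -> finite_set (base k).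
Proof.
move=> kr; apply: sub_finite_set (finite_Lev R w k) => z [zk _].
by rewrite Lev_slice.
Qed.

Definition composition_fun (m i : nat) (t : composition m i) (j : 'I_r) : nat :=
  nth 0%N (map val (val (val t))) j.

Lemma sum_composition_fun (m i : nat) (t : composition m i) : (i.+1 <= r)%N ->
  (\sum_(j < r | (j < i.+1)%N) composition_fun t j + i.+1 = m)%N.
Proof.
move=> ir; have /eqP tE := valP t; apply: etrans tE; congr addn.
rewrite (big_ord_narrow ir) /= -(big_map val xpredT id) (big_nth 0%N) big_mkord.
by rewrite size_map size_tuple.
Qed.

Lemma composition_fun_inj (m i : nat) (t u : composition m i) : (i.+1 <= r)%N ->
  (forall j : 'I_r, (j < i.+1)%N -> composition_fun t j = composition_fun u j) ->
  t = u.
Proof.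
move=> ir tu; apply/val_inj/val_inj/(inj_map val_inj)/(@eq_from_nth _ 0%N).
  by rewrite !size_map !size_tuple.
move=> j; rewrite size_map size_tuple => ji.
exact: (tu (Ordinal (leq_trans ji ir))).
Qed.

(** The decomposition puts the slice in bijection with triples of an index, a base point and a
    composition. *)
Lemma card_slice (m : nat) : (0 < m)%N ->
  card_set (slice m) = (\sum_(i < r) card_set (base i.+1) * 'C(m.-1, i))%N.
Proof.
move=> m0; pose F (i : 'I_r) : finType := (fset_set (base i.+1) * composition m i)%type.
pose f (p : {i : 'I_r & F i}) : 'rV[int]_N :=
  val (tagged p).1 + shift (tag p).+1 (composition_fun (tagged p).2).
have finb (i : 'I_r) : finite_set (base i.+1).
  by apply: finite_base; rewrite /= ltn_ord.
have inF (i : 'I_r) (z : fset_set (base i.+1)) : base i.+1 (val z).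
  by have := valP z; rewrite in_fset_set // inE.
have f_inj : injective f.
  move=> [i [z t]] [j [y u]]; rewrite /f /= => zy.
  have [[/val_inj ij] zyE] := base_shift_uniq (inF _ z) (inF _ y) zy.
  subst j; move: zyE => /val_inj zyE; subst y.
  congr (Tagged F (_, _)); apply: composition_fun_inj => // k ki.
  have := congr1 (fun x => coord x 0 k) zy; rewrite !coord_shift ki.
  by move=> /addrI /eqP; rewrite eqr_nat => /eqP.
have -> : slice m = range f.
  apply/seteqP; split=> [x xm|_ [[i [z t]] _ <-]]; last first.
    rewrite /f /= -[X in slice X](sum_composition_fun t (ltn_ord i)) addnC.
    by apply: shift_slice; exact: (inF _ z).1.
  have [s [z [c []]]] := base_shift_exists m0 xm.
  case: s => // s /= sr bz xE.
  have := shift_slice s.+1 c bz.1; rewrite -xE => /(slice_uniq xm) mE.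
  pose i : 'I_r := Ordinal sr.
  have zF : z \in fset_set (base i.+1).
    by rewrite in_fset_set // inE.
  (* A coefficient is at most the total [m - s.+1], so [inord] below preserves it. *)
  have c_lt (j : 'I_r) : (j < s.+1)%N -> (c j < (m - s.+1).+1)%N.
    by move=> js; rewrite mE addKn ltnS (bigD1 j) //= leq_addr.
  pose t : s.+1.-tuple 'I_(m - s.+1).+1 :=
    [tuple inord (c (widen_ord sr j)) | j < s.+1].
  have tP : (\sum_(x <- t) x + s.+1 == m)%N.
    rewrite big_tuple {3}mE addnC (big_ord_narrow sr) /=; apply/eqP; congr addn.
    by apply: eq_bigr => j _; rewrite tnth_mktuple inordK // c_lt /=.
  exists (Tagged F ([` zF]%fset, (Sub t tP : composition m i))) => //.
  rewrite /f /= xE; congr (_ + _); apply: eq_bigr => j js; congr (_ *+ _).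
  have jt : (j < size t)%N by rewrite size_tuple.
  rewrite /composition_fun (nth_map ord0 0%N val jt).
  have := tnth_nth ord0 t (Ordinal js); rewrite tnth_mktuple /= => <-.
  by rewrite inordK ?c_lt //; congr c; apply: val_inj.
rewrite (card_set_range f_inj) card_tagged sumnE big_map big_enum /=.
apply: eq_bigr => i _; rewrite card_prod card_composition //.
by rewrite -cardfE.
Qed.

End Decomposition.

(** * Barycentric coordinates and the relative interior of a simplex *)

Section OpenSimplex.
Variables (R : realType) (n m : nat) (p : 'I_m -> 'rV[R]_n).

(** Appending 1 turns affine relations between the points into linear relations between rows. *)
Definition homogenization : 'M[R]_(m, n + 1) :=
  \matrix_i row_mx (p i) (const_mx 1).

Lemma mulmx_homogenization (c : 'rV[R]_m) :
  c *m homogenization =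
  row_mx (\sum_i c 0 i *: p i) (const_mx (\sum_i c 0 i)).
Proof.
apply/rowP => j; rewrite mxE; case: (split_ordP j) => k ->.
  rewrite row_mxEl summxE; apply: eq_bigr => i _.
  by rewrite mxE row_mxEl mxE.
rewrite row_mxEr mxE; apply: eq_bigr => i _.
by rewrite mxE row_mxEr mxE mulr1.
Qed.

Hypothesis p_indep : affinely_independent p.

Lemma homogenization_free : row_free homogenization.
Proof.
apply: inj_row_free => c; rewrite mulmx_homogenization -row_mx0.
case/eq_row_mx => c0 /rowP /(_ 0); rewrite !mxE => c1.
by apply/rowP => i; rewrite mxE (p_indep c1 c0).
Qed.

Lemma affine_coord_uniq (b c : 'I_m -> R) : \sum_i b i = \sum_i c i ->
  \sum_i b i *: p i = \sum_i c i *: p i -> forall i, b i = c i.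
Proof.
move=> bc1 bc i; apply/eqP; rewrite -subr_eq0; apply/eqP.
apply: (p_indep (c := fun i => b i - c i)).
  by rewrite sumrB bc1 subrr.
under eq_bigr do rewrite scalerBl.
by rewrite sumrB bc subrr.
Qed.

Lemma combination_of_combinations (l : nat) (q : 'I_l -> 'rV[R]_n) (c : 'I_l -> R)
    (C : 'I_l -> 'I_m -> R) :
  (forall k, \sum_i C k i = 1) -> (forall k, q k = \sum_i C k i *: p i) ->
  \sum_i \sum_k c k * C k i = \sum_k c k /\
  \sum_k c k *: q k = \sum_i (\sum_k c k * C k i) *: p i.
Proof.
move=> C1 qC; split.
  by rewrite exchange_big; apply: eq_bigr => k _; rewrite -mulr_sumr C1 mulr1.
under [RHS]eq_bigr do rewrite scaler_suml.
rewrite exchange_big; apply: eq_bigr => k _; rewrite qC scaler_sumr.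
by apply: eq_bigr => i _; rewrite scalerA.
Qed.

Lemma convex_hull_rangeP (x : 'rV[R]_n) : convex_hull (range p) x <->
  exists c : 'I_m -> R, [/\ forall i, 0 <= c i, \sum_i c i = 1
                          & x = \sum_i c i *: p i].
Proof.
split=> [[l [q [c [qp c0 c1 ->]]]]|[c [c0 c1 ->]]]; last first.
  by exists m, p, c; split=> // i; exists i.
have /boolp.choice[f fq] k : exists i, p i = q k by case: (qp k) => i _; exists i.
have C1 k : \sum_i (i == f k)%:R = 1 :> R.
  by rewrite (bigD1 (f k)) //= eqxx big1 ?addr0 // => i /negbTE ->.
have qC k : q k = \sum_i (i == f k)%:R *: p i.
  rewrite (bigD1 (f k)) //= eqxx scale1r fq big1 ?addr0 // => i /negbTE ->.
  by rewrite scale0r.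
have [s1 s2] := combination_of_combinations c C1 qC.
exists (fun i => \sum_k c k * (i == f k)%:R); split=> //; last by rewrite s1.
by move=> i; apply: sumr_ge0 => k _; rewrite mulr_ge0.
Qed.

Lemma affine_hull_convex_hullP (x : 'rV[R]_n) :
  affine_hull (convex_hull (range p)) x <->
  exists c : 'I_m -> R, \sum_i c i = 1 /\ x = \sum_i c i *: p i.
Proof.
split=> [[l [q [c [qp c1 ->]]]]|[c [c1 ->]]]; last first.
  exists m, p, c; split=> // i; apply/convex_hull_rangeP.
  exists (fun j => (j == i)%:R); split=> [j||]; first by rewrite ler0n.
    by rewrite (bigD1 i) //= eqxx big1 ?addr0 // => j /negbTE ->.
  rewrite (bigD1 i) //= eqxx scale1r big1 ?addr0 // => j /negbTE ->.
  by rewrite scale0r.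
have /boolp.choice[C CP] k : exists c : 'I_m -> R,
    \sum_i c i = 1 /\ q k = \sum_i c i *: p i.
  by have /convex_hull_rangeP[e [_ e1 e2]] := qp k; exists e.
have [s1 s2] :=
  combination_of_combinations c (fun k => (CP k).1) (fun k => (CP k).2).
by exists (fun i => \sum_k c k * C k i); rewrite s1.
Qed.

(** Barycentric coordinates extend to continuous affine functions on the whole space, so strict
    positivity persists nearby. *)
Lemma affine_coord_near (c : 'I_m -> R) : \sum_i c i = 1 ->
  (forall i, 0 < c i) ->
  \forall y \near (\sum_i c i *: p i : 'rV[R]_n), forall e : 'I_m -> R,
    \sum_i e i = 1 -> y = \sum_i e i *: p i -> forall i, 0 < e i.
Proof.
move=> c1 c0; set x := \sum_i _.
(* The upper rows of the pseudo-inverse give the linear part and its last row the constant term, the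
   appended entry being 1. *)
pose g (i : 'I_m) (y : 'rV[R]_n) : R :=
  \sum_j y 0 j * usubmx (pinvmx homogenization) j i +
  \sum_j dsubmx (pinvmx homogenization) j i.
have gE (e : 'I_m -> R) i : \sum_i e i = 1 -> g i (\sum_i e i *: p i) = e i.
  move=> e1; have : e i = ((\row_k e k) *m homogenization *m
      pinvmx homogenization) 0 i.
    by rewrite (mulmxKp homogenization_free) mxE.
  have rowE : \sum_k (\row_k e k) 0 k *: p k = \sum_k e k *: p k.
    by apply: eq_bigr => k _; rewrite mxE.
  have row1 : \sum_k (\row_k e k) 0 k = 1.
    by rewrite -e1; apply: eq_bigr => k _; rewrite mxE.
  rewrite mulmx_homogenization rowE row1 -[pinvmx _ in RHS]vsubmxK mul_row_col => ->.
  rewrite mxE; congr (_ + _); rewrite mxE; apply: eq_bigr => j _ //.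
  by rewrite [const_mx _ _ _]mxE mul1r.
have g_cont i : g i y @[y --> x] --> g i x.
  apply: (@cvgD _ _ _ (nbhs x) _); last exact: cvg_cst.
  apply: (@cvg_big _ _ _ _ _ _ _ (nbhs x) _ _ _ _) => [|j _].
    exact: add_continuous.
  apply: (@cvgM _ _ (nbhs x) _); [exact: coord_continuous|exact: cvg_cst].
have : \forall y \near x, forall i, 0 < g i y.
  apply: (@filter_forall _ _ _ (nbhs x) _) => i.
  apply: (@cvgr_gt _ _ (nbhs x) _ _ (g i x)); first exact: g_cont.
  by rewrite gE.
by apply: (@filterS _ (nbhs x) _) => y y0 e e1 yE i; rewrite -(gE e i e1) -yE.
Qed.

(** If a coordinate vanishes, a small move away from its vertex stays in the affine hull and makes
    it negative. If all are positive, [affine_coord_near] applies. *)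
Lemma relative_interior_simplexP (x : 'rV[R]_n) :
  relative_interior (convex_hull (range p)) x <->
  exists c : 'I_m -> R, [/\ forall i, 0 < c i, \sum_i c i = 1
                          & x = \sum_i c i *: p i].
Proof.
split=> [[/convex_hull_rangeP[c [c0 c1 xE]] xn]|[c [c0 c1 ->]]]; last first.
  split.
    by apply/convex_hull_rangeP; exists c; split=> // i; exact: ltW.
  have := affine_coord_near c1 c0; apply: filterS => y yP.
  move=> /affine_hull_convex_hullP[e [e1 yE]]; apply/convex_hull_rangeP.
  by exists e; split=> // i; apply/ltW/(yP e).
exists c; split=> // i; rewrite lt_neqAle c0 andbT eq_sym; apply/eqP => ci0.
have : (x + t *: (x - p i)) @[t --> (0 : R)] --> x + 0 *: (x - p i).
  by apply: cvgD; [exact: cvg_cst|apply: cvgZr_tmp; exact: cvg_id].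
rewrite scale0r addr0 => /(_ _ xn) /nbhs_ballP[eps /= eps0 epsP].
have [t t0 tP] : exists2 t : R, 0 < t & ball (0 : R) eps t.
  exists (eps / 2); first by rewrite divr_gt0.
  by rewrite /ball /= sub0r normrN gtr0_norm; lra.
(* Coordinates of [x + t *: (x - p i)]; since [c i = 0], the one at [i] is [- t]. *)
pose e j := (1 + t) * c j - t * (j == i)%:R.
have e1 : \sum_j e j = 1.
  rewrite sumrB -!mulr_sumr c1 (bigD1 i) //= eqxx big1 => [|j /negbTE -> //].
  by rewrite addr0 !mulr1 addrK.
have eE : x + t *: (x - p i) = \sum_j e j *: p j.
  under eq_bigr do rewrite scalerBl -!scalerA.
  rewrite sumrB -!scaler_sumr -xE (bigD1 i) //= eqxx scale1r.
  rewrite big1 => [|j /negbTE ->]; last by rewrite scale0r.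
  by rewrite addr0 scalerDl scale1r scalerBr addrA.
have /= H := epsP _ tP.
have /convex_hull_rangeP[b [b0 b1 bE]] : convex_hull (range p) (x + t *: (x - p i)).
  by apply: H; apply/affine_hull_convex_hullP; exists e.
have := b0 i; rewrite (affine_coord_uniq (etrans b1 (esym e1)) (etrans (esym bE) eE)).
by rewrite /e ci0 eqxx mulr0 mulr1 sub0r; lra.
Qed.

End OpenSimplex.

(** * Shifted binomial polynomials as a basis *)

Section FallingFactorialBasis.
Variable R : realType.

Lemma rbinom_nat (m i : nat) : rbinom (m%:R : R) i = ('C(m, i))%:R.
Proof.
rewrite /rbinom; have -> : \prod_(j < i) (m%:R - j%:R) = (m ^_ i)%:R :> R.
  elim: i => [|i IH]; first by rewrite big_ord0.
  (* For [m < i] the truncated [m - i] is wrong, but the product so far is already 0. *)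
  rewrite big_ord_recr /= IH ffactnSr natrM; have [im|mi] := leqP i m.
    by rewrite natrB.
  by rewrite ffact_small // !mul0r.
by rewrite -bin_ffact natrM mulfK // pnatr_eq0 -lt0n fact_gt0.
Qed.

Definition shifted_binom_poly (i : nat) : {poly R} :=
  (i`!)%:R^-1 *: \prod_(j < i) ('X - (1 + j%:R)%:P).

Lemma horner_shifted_binom_poly (i : nat) (x : R) :
  (shifted_binom_poly i).[x] = rbinom (x - 1) i.
Proof.
rewrite hornerZ horner_prod mulrC; congr (_ / _).
by apply: eq_bigr => j _; rewrite hornerXsubC opprD addrA.
Qed.

Lemma size_shifted_binom_poly (i : nat) : (size (shifted_binom_poly i) <= i.+1)%N.
Proof.
apply: leq_trans (size_scale_leq _ _) _.
rewrite -(big_mkord xpredT (fun j => 'X - (1 + j%:R)%:P)) size_prod_XsubC.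
by rewrite size_iota subn0.
Qed.

(** The difference has at least as many distinct roots as its size. *)
Lemma poly_nat_inj (p q : {poly R}) :
  (forall k : nat, (0 < k)%N -> p.[k%:R] = q.[k%:R]) -> p = q.
Proof.
move=> pq; apply/eqP; rewrite -subr_eq0; apply/eqP.
pose rs : seq R := [seq k.+1%:R | k <- iota 0 (size (p - q))].
apply: (@roots_geq_poly_eq0 _ _ rs).
- apply/allP => _ /mapP[k _ ->].
  by rewrite rootE hornerD hornerN pq // subrr.
- rewrite map_inj_uniq ?iota_uniq // => a b /eqP.
  by rewrite eqr_nat => /eqP[].
- by rewrite size_map size_iota.
Qed.

(** Evaluation at [k + 1] is unitriangular: terms with [i > k] vanish and the one with [i = k] has
    factor 1. *)
Lemma rbinom_sum_inj (d : nat) (f g : 'rV[R]_d.+1) :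
  (forall x : R, \sum_(i < d.+1) f 0 i * rbinom (x - 1) i =
                 \sum_(i < d.+1) g 0 i * rbinom (x - 1) i) -> f = g.
Proof.
move=> fg; suff H k (kd : (k < d.+1)%N) : f 0 (Ordinal kd) = g 0 (Ordinal kd).
  by apply/rowP => -[k kd].
elim/ltn_ind: k kd => k IH kd; have := fg k.+1%:R.
rewrite -natr1 addrK (bigD1 (Ordinal kd)) //= [in RHS](bigD1 (Ordinal kd)) //=.
rewrite rbinom_nat binn !mulr1.
rewrite (_ : \sum_(i < _ | _) f 0 i * _ =
             \sum_(i < d.+1 | i != Ordinal kd) g 0 i * rbinom k%:R i).
  exact: addIr.
apply: eq_bigr => -[i id] /=; rewrite -val_eqE /= neq_ltn => /orP[ik|ki].
  by rewrite IH.
by rewrite rbinom_nat bin_small // !mulr0.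
Qed.

End FallingFactorialBasis.

(** * The cone over the simplex and its Ehrhart polynomial *)

Section Cone.
Variables (R : realType) (n d : nat) (v : 'I_d.+1 -> 'rV[int]_n).
Hypothesis hv : affinely_independent (fun i => real_point R (v i)).

Let a (i : 'I_d.+1) := row_mx (v i) (const_mx 1 : 'rV[int]_1).

Lemma real_point_row_mx (y : 'rV[int]_n) (k : int) :
  real_point R (row_mx y (const_mx k : 'rV[int]_1)) =
  row_mx (real_point R y) (const_mx k%:~R).
Proof. by rewrite /real_point map_row_mx map_const_mx. Qed.

Lemma gen_mx_homogenization :
  gen_mx R a = homogenization (fun i => real_point R (v i)).
Proof. by apply/row_matrixP => i; rewrite !rowK real_point_row_mx. Qed.

Lemma cone_gen_free : row_free (gen_mx R a).
Proof. by rewrite gen_mx_homogenization; exact: homogenization_free. Qed.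

(** The height is the last entry of [z], because every generator ends in 1. *)
Lemma cone_integral_height (z : 'rV[int]_(n + 1)) : in_span R a z ->
  (forall i, 0 < coord R a z 0 i) ->
  exists m : nat, \sum_i coord R a z 0 i = m%:R.
Proof.
rewrite /in_span gen_mx_homogenization mulmx_homogenization => zE z0.
have /rowP /(_ (rshift n 0)) := zE; rewrite row_mxEr !mxE => hz.
have : 0 <= (z 0 (rshift n 0))%:~R :> R.
  by rewrite hz; apply: sumr_ge0 => i _; exact: ltW.
by rewrite ler0z -hz; case: (z 0 _) => // m _; exists m.
Qed.

(** Dividing coordinates in the cone by [k] gives barycentric coordinates, whose sum is 1. *)
Lemma slice_dilate (k : nat) : (0 < k)%N ->
  slice R a k =
  [set row_mx y (const_mx k%:Z : 'rV[int]_1) |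
     y in lattice_points (dilate k (open_simplex R v))].
Proof.
move=> k0; have kR : k%:R != 0 :> R by rewrite pnatr_eq0 -lt0n.
apply/seteqP; split=> [z [zs z0 zk]|_ [y [x xD xy] <-]].
  move: zs; rewrite /in_span gen_mx_homogenization mulmx_homogenization zk => zE.
  exists (lsubmx z).
    exists (k%:R^-1 *: real_point R (lsubmx z)); last first.
      by rewrite scalerA divff // scale1r.
    apply/(relative_interior_simplexP hv).
    exists (fun i => k%:R^-1 * coord R a z 0 i); split.
    - by move=> i; rewrite mulr_gt0 // invr_gt0 ltr0n.
    - by rewrite -mulr_sumr zk mulVf.
    have -> : real_point R (lsubmx z) = lsubmx (real_point R z).
      by rewrite /real_point map_lsubmx.
    rewrite zE row_mxKl scaler_sumr.
    by apply: eq_bigr => i _; rewrite scalerA.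
  apply: (@real_point_inj R); rewrite real_point_row_mx zE; congr row_mx.
  by rewrite /real_point map_lsubmx -/(real_point R z) zE row_mxKl.
have /(relative_interior_simplexP hv)[c [c0 c1 xE]] := xD.
have [] := @coordE R _ _ a cone_gen_free (row_mx y (const_mx k%:Z))
  (fun i => k%:R * c i).
  have := mulmx_homogenization (fun i => real_point R (v i)) (\row_i (k%:R * c i)).
  rewrite -gen_mx_homogenization mulmx_sum_row real_point_row_mx -xy xE.
  under eq_bigr do rewrite rowK mxE.
  move=> ->; congr row_mx.
    rewrite scaler_sumr; apply: eq_bigr => i _; by rewrite mxE scalerA.
  congr const_mx; under [RHS]eq_bigr do rewrite mxE.
  by rewrite -mulr_sumr c1 mulr1.
move=> ys yc; split=> // [i|]; first by rewrite yc mulr_gt0 // ltr0n.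
by under eq_bigr do rewrite yc; rewrite -mulr_sumr c1 mulr1.
Qed.

Lemma ehrhart_sum (k : nat) : (0 < k)%N ->
  ehrhart (open_simplex R v) k =
  (\sum_(i < d.+1) card_set (base R a i.+1) * 'C(k.-1, i))%N.
Proof.
move=> k0; rewrite -(card_slice cone_gen_free cone_integral_height k0).
rewrite slice_dilate // card_set_image //.
  exact: finite_dilate_open_simplex.
by move=> x y /eq_row_mx[].
Qed.

(** The sum satisfies the size bound and, by [ehrhart_sum], has the right values, so [xget] does not
    fall back on its default; [poly_nat_inj] gives uniqueness. *)
Lemma ehrhart_polyE : ehrhart_poly d (open_simplex R v) =
  \sum_(i < d.+1) (card_set (base R a i.+1))%:R *: shifted_binom_poly R i.
Proof.
set p := \sum_(i < d.+1) _.
have pk k : (0 < k)%N -> p.[k%:R] = (ehrhart (open_simplex R v) k)%:R.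
  case: k => // k _; rewrite ehrhart_sum // horner_sum natr_sum.
  apply: eq_bigr => i _; rewrite hornerZ horner_shifted_binom_poly.
  by rewrite -natr1 addrK rbinom_nat natrM.
apply: xget_unique => [|q [_ qk]].
  split=> //; apply: (leq_trans (size_sum _ _ _)); apply/bigmax_leqP => i _.
  apply: (leq_trans (size_scale_leq _ _)).
  exact: leq_trans (size_shifted_binom_poly R i) (ltn_ord i).
by apply: poly_nat_inj => k k0; rewrite qk ?pk.
Qed.

End Cone.

Theorem theorem1p1 (R : realType) (n d d' : nat)
    (v : 'I_d.+1 -> 'rV[int]_n)
    (hv : affinely_independent (fun i => real_point R (v i)))
    (hd : (d <= d')%N) :
  let Delta := open_simplex R v in
  let a := fun i : 'I_d.+1 => row_mx (v i) (const_mx 1 : 'rV[int]_1) in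
  forall i : 'I_d'.+1,
    fstar (ehrhart_poly d Delta) d' 0 i =
      (card_set (atomic R a `&` Lev R a i.+1))%:R.
Proof.
move=> Delta a i; pose t (j : nat) := card_set (atomic R a `&` Lev R a j.+1).
suff -> : fstar (ehrhart_poly d Delta) d' = \row_(j < d'.+1) (t j)%:R.
  by rewrite mxE.
have tE x : (ehrhart_poly d Delta).[x] =
    \sum_(j < d'.+1) (\row_(j < d'.+1) (t j)%:R : 'rV[R]_d'.+1) 0 j *
                     rbinom (x - 1) j.
  rewrite (ehrhart_polyE hv) horner_sum.
  pose F j := (t j)%:R * rbinom (x - 1) j.
  transitivity (\sum_(j < d.+1) F j).
    apply: eq_bigr => j _; rewrite hornerZ horner_shifted_binom_poly /F /t.
    rewrite (atomic_Lev (cone_gen_free hv) (@cone_integral_height _ _ _ v)) //.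
    by rewrite /= ltn_ord.
  (* Levels above [d.+1] are empty, so extending the sum to [d'.+1] terms adds only zeros. *)
  rewrite (big_ord_widen d'.+1 F) // big_mkcond; apply: eq_bigr => j _.
  rewrite mxE /F; case: ltnP => // dj; rewrite /t (Lev_gt (cone_gen_free hv)) //.
  by rewrite setI0 /card_set fset_set0 cardfs0 mul0r.
(* [tE] gives one valid expansion, and there is no other, so [xget] returns it. *)
apply: xget_unique => // f fP; apply: rbinom_sum_inj => x.
by rewrite -fP tE.
Qed.
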